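(* Let $|\varphi\rangle$ and $|\psi\rangle$ be two $N$-partite pure states in $\mathcal{H}=\mathcal{H}_1\otimes\cdots\otimes\mathcal{H}_N$, $\dim\mathcal{H}_i=d_i$, with coefficient tensors $\mathcal{X}$ and $\mathcal{Y}$ respectively. Then $|\varphi\rangle$ and $|\psi\rangle$ are SLOCC equivalent if and only if there exist invertible matrices $M_i\in GL(d_i,\mathbb{C})$ ($i=1,\dots,N$) such that the mode-$i$ matricizations $X_{(i)}$ of $\mathcal{X}$ and $Y_{(i)}$ of $\mathcal{Y}$ satisfy $$Y_{(i)}=M_i\,X_{(i)}\,(M_N\otimes\cdots\otimes M_{i+1}\otimes M_{i-1}\otimes\cdots\otimes M_1)^{\mathrm t}\qquad (i=1,2,\dots,N).$$
   Context: Each $\mathcal{H}_t$ is a complex Hilbert space of finite dimension $d_t$ with a fixed orthonormal basis $|1\rangle,\dots,|d_t\rangle$. A pure state is a unit vector $\sum_{j_1,\dots,j_N}\alpha_{j_1\cdots j_N}|j_1\cdots j_N\rangle$ of $\mathcal{H}$, and its coefficient tensor is the array $(\alpha_{j_1\cdots j_N})\in\mathbb{C}^{d_1\times\cdots\times d_N}$. Operators on $\mathcal{H}_t$ are identified with $d_t\times d_t$ matrices via the fixed basis. Two pure states $|\varphi\rangle,|\psi\rangle$ are SLOCC equivalent if $|\varphi\rangle=(M_1\otimes\cdots\otimes M_N)|\psi\rangle$ for some $M_i\in GL(d_i,\mathbb{C})$. The mode-$n$ matricization $X_{(n)}$ of a tensor $\mathcal{X}=(x_{i_1\cdots i_N})$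 of size $d_1\times\cdots\times d_N$ is the $d_n\times\prod_{m\ne n}d_m$ matrix whose $(i_n,j)$ entry is $x_{i_1\cdots i_N}$, where $j=1+\sum_{k\neq n}(i_k-1)\beta_k$ and $\beta_k=\prod_{m<k,\ m\neq n}d_m$. The symbol $\otimes$ between matrices is the Kronecker product, and $\mathrm t$ denotes transpose (without conjugation). *)

(* Defs.v *)
From mathcomp Require Import all_boot all_order all_algebra.
From mathcomp Require Import reals.
From mathcomp Require Export complex mxtens.

Set Implicit Arguments.
Unset Strict Implicit.
Unset Printing Implicit Defensive.

Import Order.TTheory GRing.Theory Num.Theory.
Local Open Scope ring_scope.

(* The complex numbers are [R[i]] for [R : realType].                         *)
(* Modes are the elements of ['I_N], and all indices start at 0 instead of 1. *)

Definition mindex (N : nat) (d : 'I_N -> nat) : finType :=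
  {dffun forall t : 'I_N, 'I_(d t)}.

Definition tensor (R : realType) (N : nat) (d : 'I_N -> nat) : Type :=
  mindex d -> R[i].

(* H_1 (x) ... (x) H_N, where H_t is the space of column vectors of size d t  *)
(* with its standard basis; its elements are given by their coordinates in    *)
(* the orthonormal product basis, see [ket].                                  *)
Definition hspace (R : realType) (N : nat) (d : 'I_N -> nat) : lmodType R[i] :=
  {ffun mindex d -> R[i]}.

Section States.
Variables (R : realType) (N : nat) (d : 'I_N -> nat).
Implicit Types (v : forall t, 'cV[R[i]]_(d t)) (M : forall t, 'M[R[i]]_(d t)).

Definition prodvec v : hspace R d :=
  [ffun j : mindex d => \prod_(t < N) v t (j t) 0].

Definition ket (j : mindex d) : hspace R d :=
  prodvec (fun t => delta_mx (j t) 0).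

Lemma ketE (j k : mindex d) : (ket j : {ffun _}) k = (k == j)%:R.
Proof.
rewrite ffunE; case: eqVneq => [->|neq_kj].
  by rewrite big1 // => t _; rewrite mxE !eqxx.
have /existsP[t neq_t] : [exists t, k t != j t].
  rewrite -negb_forall; apply: contra neq_kj => /forallP eq_kj.
  by apply/eqP/ffunP => t; apply/eqP.
by rewrite (bigD1 t) //= mxE (negPf neq_t) mul0r.
Qed.

Definition of_tensor (X : tensor R d) : hspace R d :=
  \sum_(j : mindex d) X j *: ket j.

Lemma of_tensorE (X : tensor R d) j : (of_tensor X : {ffun _}) j = X j.
Proof.
rewrite sum_ffunE (bigD1 j) //= big1 => [|k neq_kj].
  by rewrite ffunE ketE eqxx addr0 /GRing.scale /= mulr1.
by rewrite ffunE ketE eq_sym (negPf neq_kj) scaler0.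
Qed.

Definition pure_state (phi : hspace R d) : Prop :=
  \sum_(j : mindex d) `|(phi : {ffun _}) j| ^+ 2 = 1.

(* The operator M_1 (x) ... (x) M_N: the linear map sending each product      *)
(* basis vector |j_1 ... j_N> to M_1|j_1> (x) ... (x) M_N|j_N>.               *)
Definition tensop M (psi : hspace R d) : hspace R d :=
  \sum_(j : mindex d)
    (psi : {ffun _}) j *: prodvec (fun t => M t *m delta_mx (j t) 0).

Definition slocc_equiv (phi psi : hspace R d) : Prop :=
  exists M : forall t, 'M[R[i]]_(d t),
    (forall t, M t \in unitmx) /\ phi = tensop M psi.

End States.

Section Matricization.
Variables (N : nat) (d : 'I_N -> nat) (n : 'I_N).

Definition codim : nat := (\prod_(m < N | m != n) d m)%N.

Definition beta (k : 'I_N) : nat :=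
  (\prod_(m < N | (m < k) && (m != n)) d m)%N.

(* The 0-based column index, j - 1 in terms of the 1-based one. *)
Definition colidx (j : mindex d) : nat :=
  (\sum_(k < N | k != n) j k * beta k)%N.

Let psum p (j : mindex d) : nat :=
  (\sum_(k < N | (k < p)%N && (k != n)) j k * beta k)%N.
Let pprod p : nat := (\prod_(k < N | (k < p) && (k != n)) d k)%N.

Let pstep (T : Type) (x : T) (op : Monoid.com_law x) (F : 'I_N -> T)
    (k : 'I_N) : \big[op/x]_(l < N | (l < k.+1)%N && (l != n)) F l =
  op (if k != n then F k else x) (\big[op/x]_(l < N | (l < k)%N && (l != n)) F l).
Proof.
case: ifP => [kn|/negbFE/eqP kn].
  rewrite (bigD1 k) /= ?ltnSn ?kn //; congr (op _ _); apply: eq_bigl => l.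
  rewrite ltnS [in RHS]ltn_neqAle -val_eqE /=.
  by rewrite andbC andbA.
rewrite (Monoid.mul1m op); apply: eq_bigl => l; rewrite ltnS [in RHS]ltn_neqAle.
by rewrite -kn -val_eqE /=; case: eqP; rewrite ?andbF ?andbT.
Qed.

Let psum_lt p (j : mindex d) : (p <= N)%N -> (psum p j < pprod p)%N.
Proof.
elim: p => [|p IHp] le_pN; first by rewrite /psum /pprod !big_pred0.
have {IHp} := IHp (ltnW le_pN).
rewrite /psum /pprod (pstep addn _ (Ordinal le_pN)).
rewrite (pstep muln _ (Ordinal le_pN)) /=.
case: ifP => _; last by rewrite mul1n add0n.
set k := Ordinal le_pN => IHp; rewrite -/(pprod p).
have -> : beta k = pprod p by [].
apply: (@leq_trans ((j k).+1 * pprod p)%N); last by rewrite leq_mul2r ltn_ord orbT.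
by rewrite mulSn addnC ltn_add2r.
Qed.

Lemma colidx_lt (j : mindex d) : (colidx j < codim)%N.
Proof.
have := psum_lt j (leqnn N); rewrite /psum /pprod /colidx /codim.
have eq_dom (k : 'I_N) : (k < N)%N && (k != n) = (k != n) by rewrite ltn_ord.
by rewrite !(eq_bigl _ _ eq_dom).
Qed.

Lemma colidx_inj (j k : mindex d) : j n = k n -> colidx j = colidx k -> j = k.
Proof.
move=> eq_n eq_c.
have eq_psum p : (p <= N)%N -> psum p j = psum p k ->
    forall l : 'I_N, (l < p)%N -> j l = k l.
  elim: p => // p IHp lt_pN.
  have := psum_lt j (ltnW lt_pN); have := psum_lt k (ltnW lt_pN).
  rewrite /psum !(pstep addn _ (Ordinal lt_pN)) -/(psum p j) -/(psum p k) /=.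
  set q := Ordinal lt_pN; have -> : beta q = pprod p by [].
  move=> lt_k lt_j eq_jk.
  have pp : (0 < pprod p)%N by apply: leq_ltn_trans lt_k.
  have [eq_q eq_p] : j q = k q /\ psum p j = psum p k.
    move: eq_jk; case: ifP => [_ eq_jk|/negbFE/eqP -> ]; last by rewrite !add0n.
    split.
      apply: val_inj; move: (congr1 (divn^~ (pprod p)) eq_jk) => /=.
      by rewrite !divnMDl // !divn_small // !addn0.
    move: (congr1 (modn^~ (pprod p)) eq_jk) => /=.
    by rewrite !modnMDl !modn_small.
  move=> l; rewrite ltnS leq_eqVlt => /orP[/eqP eq_l|]; last first.
    exact: IHp (ltnW lt_pN) eq_p l.
  by have -> : l = q by apply: val_inj.
apply/ffunP => l; apply: (eq_psum N) => //.
have eq_dom (i : 'I_N) : (i < N)%N && (i != n) = (i != n) by rewrite ltn_ord.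
by rewrite /psum !(eq_bigl _ _ eq_dom).
Qed.

(* The multi-index located at entry (i, c) of a mode-n matricization exists,  *)
(* so the default value in [matricization] is never used.                     *)
Lemma colidx_surj (i : 'I_(d n)) (c : 'I_codim) :
  exists j : mindex d, j n = i /\ colidx j = c.
Proof.
pose f (j : mindex d) := (j n, Ordinal (colidx_lt j)).
have f_inj : injective f.
  by move=> j k [eq_n eq_c]; apply: colidx_inj => //; apply: val_inj.
have card_eq : (#|{: 'I_(d n) * 'I_codim}| <= #|mindex d|)%N.
  rewrite card_prod !card_ord card_dep_ffun foldrE big_map big_enum /=.
  by rewrite (bigD1 n) //= card_ord; under eq_bigr => t _ do rewrite card_ord.
have /(_ (i, c)) := inj_card_onto f_inj card_eq.
by case/codomP => j [-> ->]; exists j.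
Qed.

Definition matricization (R : realType) (X : tensor R d) :
    'M[R[i]]_(d n, codim) :=
  \matrix_(i, c)
    if [pick j : mindex d | (j n == i) && (colidx j == c :> nat)] is Some j
    then X j else 0.

Lemma matricizationE (R : realType) (X : tensor R d) (j : mindex d) :
  matricization X (j n) (Ordinal (colidx_lt j)) = X j.
Proof.
rewrite mxE; case: pickP => [k /andP[/eqP eq_n /eqP eq_c]|/(_ j)].
  by rewrite (colidx_inj eq_n eq_c).
by rewrite !eqxx.
Qed.

End Matricization.

Section Kronecker.
Variables (R : realType) (N : nat) (d : 'I_N -> nat).
Variable M : forall t, 'M[R[i]]_(d t).

Definition dimseq (s : seq 'I_N) : nat := foldr (fun m p => d m * p)%N 1%N s.

(* M_(s_0) (x) (M_(s_1) (x) ...), ending with the neutral 1 x 1 identity.     *)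
Fixpoint kronseq (s : seq 'I_N) : 'M[R[i]]_(dimseq s) :=
  if s is m :: s' then M m *t kronseq s' else 1%:M.

Definition other_modes_desc (n : 'I_N) : seq 'I_N :=
  rev [seq m <- enum 'I_N | m != n].

Lemma dimseq_other_modes (n : 'I_N) : dimseq (other_modes_desc n) = codim d n.
Proof.
have -> s : dimseq s = (\prod_(m <- s) d m)%N.
  by elim: s => [|m s IHs]; rewrite ?big_nil ?big_cons /= ?IHs.
by rewrite (perm_big _ (permEl (perm_rev _))) big_filter big_enum_cond.
Qed.

(* M_N (x) ... (x) M_(n+1) (x) M_(n-1) (x) ... (x) M_1; the cast only         *)
(* reorders the product giving the dimension.                                 *)
Definition kron_others (n : 'I_N) : 'M[R[i]]_(codim d n) :=
  castmx (dimseq_other_modes n, dimseq_other_modes n)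
    (kronseq (other_modes_desc n)).

End Kronecker.

(* Main.v *)
(* The map j |-> (j_n, column of j) is a bijection from multi-indices onto    *)
(* the entries of a mode-n matricization, and at the columns of j and k the   *)
(* Kronecker product of the M_t, t != n, has entry the product of the         *)
(* M_t(j_t, k_t).  So for every single mode n the matricized equation says    *)
(* psi = (M_1 (x) ... (x) M_N) phi, the definition of SLOCC equivalence with  *)
(* the two states exchanged, and the M_t are inverted to exchange them back.  *)
Require Import Defs.
From mathcomp Require Import all_boot all_order all_algebra.
From mathcomp Require Import reals.
Local Open Scope ring_scope.

Set Implicit Arguments.
Unset Strict Implicit.
Unset Printing Implicit Defensive.

Import GRing.Theory.

(** Fix a mode [n]. By [entry_bij] the double sum in the matricized product is a sum over
    multi-indices, and by [kron_othersE] its coefficients are those of [tensopE]; hence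
    [matricization_tensopP], and the equations for all modes express one operator identity with the
    same matrices. That identity sends [phi] to [psi], while [slocc_equiv phi psi] goes the other
    way; [slocc_equiv_sym] reconciles them, since tensor operators compose factor by factor
    ([tensop_comp]). *)

Lemma prod_sum_mindex (A : comPzSemiRingType) (N : nat) (d : 'I_N -> nat)
    (F : forall t, 'I_(d t) -> A) :
  \prod_(t < N) \sum_(a < d t) F t a =
  \sum_(j : mindex d) \prod_(t < N) F t (j t).
Proof.
rewrite (reindex (@dffun_of_fprod _ (fun t => 'I_(d t) : finType))); last first.
  exact/onW_bij/dffun_of_fprod_bij.
pose T t : finType := 'I_(d t).
pose G t : {ffun T t -> A} := [ffun a => F t a].
transitivity (\sum_(f : fprod T) \prod_(t in 'I_N) G t (f t)).
  (* Both sides move to tagged pairs of a mode and an index, one index type common to all factors,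
     where [bigA_distr_big_dep] applies. *)
  rewrite big_fprod; under [LHS]eq_bigr => t _.
    under eq_bigr => a _ do rewrite -(ffunE (F t)).
    rewrite (big_tag G); over.
  exact: bigA_distr_big_dep.
by apply: eq_bigr => f _; apply: eq_bigr => t _; rewrite !ffunE.
Qed.

Section TensorOperator.
Variables (R : realType) (N : nat) (d : 'I_N -> nat).
Implicit Types (M : forall t, 'M[R[i]]_(d t)) (phi psi : hspace R d).

Lemma tensopE M psi (k : mindex d) :
  (tensop M psi : {ffun _}) k =
  \sum_(j : mindex d) (psi : {ffun _}) j * \prod_(t < N) M t (k t) (j t).
Proof.
rewrite sum_ffunE; apply: eq_bigr => j _; rewrite !ffunE; congr (_ * _).
by apply: eq_bigr => t _; rewrite -colE mxE.
Qed.

Lemma tensop_comp A B psi :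
  tensop A (tensop B psi) = tensop (fun t => A t *m B t) psi.
Proof.
apply/ffunP => k; rewrite !tensopE.
under eq_bigr => j _ do rewrite tensopE mulr_suml.
rewrite exchange_big; apply: eq_bigr => l _ /=.
under eq_bigr => j _ do rewrite -mulrA -big_split.
rewrite -big_distrr; congr (_ * _) => /=.
under [RHS]eq_bigr => t _ do rewrite mxE.
rewrite (prod_sum_mindex (fun t a => A t (k t) a * B t a (l t))).
by apply: eq_bigr => j _; apply: eq_bigr => t _; rewrite mulrC.
Qed.

Lemma tensopK A B psi : (forall t, A t *m B t = 1%:M) ->
  tensop A (tensop B psi) = psi.
Proof.
move=> AB1; rewrite tensop_comp; apply/ffunP => k.
(* [psi] serves as its own coefficient tensor: its expansion over kets is the sum that identity
   factors produce. *)
rewrite -[RHS](of_tensorE psi) /of_tensor !sum_ffunE.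
apply: eq_bigr => j _; rewrite !ffunE; congr (_ * _).
by apply: eq_bigr => t _; rewrite AB1 mul1mx.
Qed.

Lemma slocc_equiv_sym phi psi : slocc_equiv phi psi -> slocc_equiv psi phi.
Proof.
case=> M [unitM ->]; exists (fun t => invmx (M t)); split=> [t|].
  by rewrite unitmx_inv.
by rewrite tensopK // => t; rewrite mulVmx.
Qed.

End TensorOperator.

Section KroneckerEntries.
Variables (R : realType) (N : nat) (d : 'I_N -> nat).
Variable M : forall t, 'M[R[i]]_(d t).
Implicit Types (s : seq 'I_N) (j k : mindex d).

Fixpoint kronidx s j : 'I_(dimseq d s) :=
  if s is m :: s' then mxtens_index (j m, kronidx s' j) else ord0.

Lemma kronseqE s j k :
  kronseq M s (kronidx s j) (kronidx s k) = \prod_(t <- s) M t (j t) (k t).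
Proof.
elim: s => [|m s IHs] /=; first by rewrite big_nil mxE.
by rewrite tensmxE IHs big_cons.
Qed.

Lemma dimseqE s : dimseq d s = (\prod_(m <- s) d m)%N.
Proof. by elim: s => [|m s IHs]; rewrite ?big_nil ?big_cons /= ?IHs. Qed.

(** The first Kronecker factor is the most significant mixed-radix digit; in a decreasing list, the
    modes after [m] are exactly those below [m], and their total dimension is its weight. *)
Lemma kronidxE s j : pairwise (fun k l : 'I_N => l < k)%N s ->
  kronidx s j = (\sum_(k <- s) j k * \prod_(m <- s | m < k) d m)%N :> nat.
Proof.
elim: s => [|m s IHs] /=; first by rewrite big_nil.
case/andP=> /allP lt_m /IHs ->; rewrite big_cons; congr (_ * _ + _)%N.
  rewrite dimseqE big_cons ltnn big_seq [RHS]big_seq_cond.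
  by apply: eq_bigl => l; case: (boolP (l \in s)) => // /lt_m ->.
rewrite big_seq [RHS]big_seq; apply: eq_bigr => l /lt_m lt_lm.
by rewrite big_cons ltnNge (ltnW lt_lm).
Qed.

Lemma perm_other_modes_desc (n : 'I_N) :
  perm_eq (other_modes_desc n) [seq m <- enum 'I_N | m != n].
Proof. by rewrite perm_rev. Qed.

Lemma pairwise_other_modes_desc (n : 'I_N) :
  pairwise (fun k l : 'I_N => l < k)%N (other_modes_desc n).
Proof.
rewrite -sorted_pairwise; last first.
  by move=> x y z /= lt1 lt2; apply: ltn_trans lt2 lt1.
rewrite rev_sorted; apply: sorted_filter.
  by move=> x y z /=; apply: ltn_trans.
by have := iota_ltn_sorted 0 N; rewrite -val_enum_ord sorted_map.
Qed.

(** The descending order of the factors makes the lowest mode vary fastest, as the weights [beta]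
    require. *)
Lemma kronidx_colidx (n : 'I_N) j :
  kronidx (other_modes_desc n) j = colidx n j :> nat.
Proof.
rewrite kronidxE ?pairwise_other_modes_desc //.
rewrite (perm_big _ (perm_other_modes_desc n)) big_filter big_enum_cond.
apply: eq_bigr => k _.
rewrite (perm_big _ (perm_other_modes_desc n)) big_filter_cond big_enum_cond.
by apply: congr1; apply: eq_bigl => l; rewrite [RHS]andbC.
Qed.

Lemma kron_othersE (n : 'I_N) j k :
  kron_others M n (Ordinal (colidx_lt n j)) (Ordinal (colidx_lt n k)) =
  \prod_(t < N | t != n) M t (j t) (k t).
Proof.
have castE l : cast_ord (esym (dimseq_other_modes d n))
    (Ordinal (colidx_lt n l)) = kronidx (other_modes_desc n) l.
  by apply: val_inj; rewrite /= kronidx_colidx.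
rewrite /kron_others castmxE !castE kronseqE.
by rewrite (perm_big _ (perm_other_modes_desc n)) big_filter big_enum_cond.
Qed.

End KroneckerEntries.

Section MatricizedOperator.
Variables (R : realType) (N : nat) (d : 'I_N -> nat) (n : 'I_N).

Definition entry (j : mindex d) : 'I_(d n) * 'I_(codim d n) :=
  (j n, Ordinal (colidx_lt n j)).

Lemma entry_bij : bijective entry.
Proof.
apply: inj_card_bij.
  by move=> j k [] /colidx_inj.
rewrite card_prod !card_ord card_dep_ffun foldrE big_map big_enum /=.
by rewrite (bigD1 n) //= card_ord; under [in leqRHS]eq_bigr do rewrite card_ord.
Qed.

Lemma matricization_tensopP (M : forall t, 'M[R[i]]_(d t)) (X Y : tensor R d) :
  matricization n Y = M n *m matricization n X *m (kron_others M n)^T <->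
  of_tensor Y = tensop M (of_tensor X).
Proof.
have rhsE (k : mindex d) : (M n *m matricization n X *m (kron_others M n)^T)
    (k n) (Ordinal (colidx_lt n k)) = (tensop M (of_tensor X) : {ffun _}) k.
  rewrite tensopE mxE; under eq_bigr => c _.
    rewrite [_^T _ _]mxE [X in X * _]mxE mulr_suml; over.
  rewrite exchange_big pair_bigA (reindex entry) /=; last first.
    exact/onW_bij/entry_bij.
  apply: eq_bigr => j _; rewrite of_tensorE matricizationE kron_othersE.
  (* The factor at [n] comes from left multiplication by [M n], the others from the Kronecker
     product. *)
  by rewrite [in RHS](bigD1 n) //= mulrCA mulrA.
split=> [eqY|eqY].
  by apply/ffunP => k; rewrite of_tensorE -rhsE -eqY matricizationE.
apply/matrixP => a c; have [j [<- eq_c]] := colidx_surj a c.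
have <- : Ordinal (colidx_lt n j) = c by apply: val_inj.
by rewrite matricizationE rhsE -eqY of_tensorE.
Qed.

End MatricizedOperator.

Theorem theorem2 (R : realType) (N : nat) (hN : (0 < N)%N) (d : 'I_N -> nat)
    (phi psi : hspace R d) (X Y : tensor R d)
    (hphi : pure_state phi) (hpsi : pure_state psi)
    (hX : phi = of_tensor X) (hY : psi = of_tensor Y) :
  slocc_equiv phi psi <->
  exists M : forall t : 'I_N, 'M[R[i]]_(d t),
    (forall i : 'I_N, M i \in unitmx) /\
    (forall i : 'I_N,
      matricization i Y = M i *m matricization i X *m (kron_others M i)^T).
Proof.
have slocc_psi : slocc_equiv phi psi <-> slocc_equiv psi phi.
  by split; apply: slocc_equiv_sym.
rewrite slocc_psi hX hY; split=> -[M [unitM eqM]]; exists M; split=> //.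
  by move=> i; apply/matricization_tensopP.
(* The equation at the first mode, which exists by [hN], yields the operator identity. *)
exact/(matricization_tensopP (Ordinal hN)).
Qed.
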